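(* For $n \ge 0$ let $R(n)$ be the largest positive integer that can be reached from $1$ by applying the Choix de Bruxelles operation exactly $n$ times (in succession). Then for all $n \ge 14$, $$8.112\cdot 10^{n-6} < R(n) \le 8.113\cdot 10^{n-6}.$$
   Context: The Choix de Bruxelles operation: given a positive integer $n$ with decimal expansion $d_1 d_2 \ldots d_k$, choose indices $1 \le p \le q \le k$ with $d_p \neq 0$, let $s$ be the number with decimal representation $d_p d_{p+1}\ldots d_q$, and replace this substring in situ by the decimal expansion of $2s$, or, if $s$ is even, by the decimal expansion of $s/2$. One may also leave $n$ unchanged (empty substring). *)

(* Defs.v *)
From mathcomp Require Import all_boot.

Set Implicit Arguments.
Unset Strict Implicit.
Unset Printing Implicit Defensive.

(* Decimal expansion of n > 0, most significant digit first. *)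
Definition digits (n : nat) : seq nat :=
  rev (mkseq (fun i => n %/ 10 ^ i %% 10) (trunc_log 10 n).+1).

Definition of_digits (w : seq nat) : nat :=
  foldl (fun a d => 10 * a + d) 0 w.

(* Indices are 0-based: substr n p q is the number written d_p ... d_q,
   and splice n p q t replaces these digits in situ by those of t. *)
Definition substr (n p q : nat) : nat :=
  of_digits (drop p (take q.+1 (digits n))).

Definition splice (n p q t : nat) : nat :=
  of_digits (take p (digits n) ++ digits t ++ drop q.+1 (digits n)).

Definition choix_at (n p q : nat) : seq nat :=
  let s := substr n p q in
  if nth 0 (digits n) p == 0 then [::]
  else splice n p q (2 * s) :: (if odd s then [::] else [:: splice n p q s./2]).

(* All results of one Choix de Bruxelles operation applied to n; the leading
   n is the choice of the empty substring. *)
Definition choix (n : nat) : seq nat :=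
  let k := size (digits n) in
  n :: flatten [seq choix_at n p q | p <- iota 0 k, q <- iota p (k - p)].

Definition reachable (n : nat) : seq nat :=
  iter n (fun l => flatten (map choix l)) [:: 1].

Definition R (n : nat) : nat := \max_(m <- reachable n) m.

Lemma R_reachable n : R n \in reachable n.
Proof.
have max_in (l : seq nat) : l != [::] -> \max_(m <- l) m \in l.
  elim: l => // x [|y l] IHl _; first by rewrite big_seq1 mem_head.
  rewrite big_cons /maxn; case: ifP => _; last exact: mem_head.
  by rewrite inE IHl ?orbT.
by apply: max_in; elim: n => //= n; case: reachable.
Qed.

Lemma R_ge n m : m \in reachable n -> m <= R n.
Proof. by move=> m_in; exact: (@leq_bigmax_seq _ _ xpredT id). Qed.

(* Main.v *)
Require Import Defs.
From mathcomp Require Import all_boot all_order all_algebra.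
From mathcomp Require Import zify ring.
Import Order.TTheory GRing.Theory Num.Theory.

(** One operation lengthens a number by at most one digit and at most doubles
    the selected block, so it multiplies the number by at most 10.  Hence
    [R (n + 1) <= 10 * R n], and the upper bound only has to be checked at
    [n = 14]; there, a number reached after [n] steps can be discarded as soon
    as it is at most [811300000 / 10 ^ (14 - n)], which leaves a few dozen
    candidates at each step.

    For the lower bound, 1, 2, 4, 8, 16, 112, 224, 448, 4416, 44112, 88224
    is followed by the self-reproducing cycle
    88224, 816448, 8164416, 81644112, 8112 88224
    which gains one digit per step and can be run behind any prefix. *)

Local Notation digit_word := (all (fun d => d < 10)).

(** The words on which [of_digits] and [digits] are inverse to each other; the default of [head]
    excludes the empty word. *)
Definition canonical (w : seq nat) : bool := digit_word w && (0 < head 0 w).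

(** * Decimal words *)

Lemma of_digits_rcons w d : of_digits (rcons w d) = 10 * of_digits w + d.
Proof. by rewrite /of_digits -cats1 foldl_cat. Qed.

Lemma of_digits_cat u v :
  of_digits (u ++ v) = of_digits u * 10 ^ size v + of_digits v.
Proof.
elim/last_ind: v => [|v d IHv]; first by rewrite cats0 muln1 addn0.
by rewrite -rcons_cat !of_digits_rcons IHv size_rcons expnS; ring.
Qed.

Lemma of_digits_cons d w : of_digits (d :: w) = d * 10 ^ size w + of_digits w.
Proof. exact: (of_digits_cat [:: d]). Qed.

Lemma of_digits_lt w : digit_word w -> of_digits w < 10 ^ size w.
Proof.
elim: w => // d w IHw /= /andP[d_lt /IHw w_lt].
by rewrite of_digits_cons expnS; nia.
Qed.

Lemma of_digits_gt0 w : 0 < head 0 w -> 0 < of_digits w.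
Proof.
case: w => // d w /= d_gt0.
by rewrite of_digits_cons addn_gt0 muln_gt0 d_gt0 expn_gt0.
Qed.

Lemma odd_of_digits w : odd (of_digits w) = odd (last 0 w).
Proof.
by case/lastP: w => // w d; rewrite of_digits_rcons last_rcons oddD oddM.
Qed.

Lemma of_digits_zeros k : of_digits (nseq k 0) = 0.
Proof. by elim: k => //= k IHk; rewrite of_digits_cons IHk. Qed.

Lemma digits_small d : d < 10 -> digits d = [:: d].
Proof.
move=> d_lt; rewrite /digits.
have -> : trunc_log 10 d = 0.
  by case: d d_lt => // d d_lt; apply: trunc_log_eq.
by rewrite /mkseq /= divn1 modn_small.
Qed.

(** Turns the closed formula of [digits] into a recursion: dividing by [10 ^ i.+1] is dividing by 10
    first, so the quotients of [a] reappear one index later. *)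
Lemma digits_rcons a d :
  0 < a -> d < 10 -> digits (10 * a + d) = rcons (digits a) d.
Proof.
move=> a_gt0 d_lt.
have a_bounds := trunc_log_bounds (isT : 1 < 10) a_gt0.
have log_ad : trunc_log 10 (10 * a + d) = (trunc_log 10 a).+1.
  apply: trunc_log_eq => //; case/andP: a_bounds => a_ge a_lt.
  by rewrite !(expnS 10 _.+1) expnS in a_lt *; lia.
rewrite /digits log_ad /mkseq.
have -> k : iota 0 k.+1 = 0 :: map (addn 1) (iota 0 k) by rewrite -iotaDl.
rewrite map_cons rev_cons divn1 -map_comp; congr rcons; last by lia.
congr rev; apply: eq_map => i /=.
by rewrite add1n [10 ^ i.+1]expnS divnMA; congr (_ %/ _ %% _); lia.
Qed.

Lemma digits_of_digits w : canonical w -> digits (of_digits w) = w.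
Proof.
case: w => // d w /andP[].
elim/last_ind: w => [|w e IHw] /=.
  by rewrite andbT => d_lt d_gt0; rewrite of_digits_cons muln1 addn0 digits_small.
rewrite all_rcons => /and3P[d_lt e_lt w_lt] d_gt0.
rewrite -rcons_cons of_digits_rcons digits_rcons ?of_digits_gt0 ?IHw //.
by rewrite /= d_lt.
Qed.

Fixpoint strip (w : seq nat) : seq nat :=
  if w is 0 :: w' then strip w' else w.

Lemma of_digits_strip w : of_digits (strip w) = of_digits w.
Proof. by elim: w => // -[|d] w IHw //=; rewrite IHw. Qed.

Lemma size_strip w : size (strip w) <= size w.
Proof. by elim: w => // -[|d] w IHw //=; apply: leqW. Qed.

Lemma strip_canonical w :
  digit_word w -> 0 < of_digits w -> canonical (strip w).
Proof.
elim: w => // -[|d] w IHw; first exact: IHw.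
by move=> w_digits _; rewrite /canonical w_digits.
Qed.

(** * Doubling and halving digit by digit *)

(* The carry into a digit is 1 exactly when the digit on its right is >= 5;
   the carry out of the first digit is dropped. *)
Fixpoint double_digits (w : seq nat) : seq nat :=
  if w is d :: w' then (2 * d %% 10 + (4 < head 0 w')) :: double_digits w'
  else [::].

(** Long division by 2 from the left, with [c] the remainder passed on by the previous digit. *)
Fixpoint half_digits (c : bool) (w : seq nat) : seq nat :=
  if w is d :: w' then (c * 10 + d)./2 :: half_digits (odd (c * 10 + d)) w'
  else [::].

Lemma size_double_digits w : size (double_digits w) = size w.
Proof. by elim: w => //= d w ->. Qed.

Lemma size_half_digits c w : size (half_digits c w) = size w.
Proof. by elim: w c => //= d w IHw c; rewrite IHw. Qed.

Lemma double_digits_digit w : digit_word (double_digits w).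
Proof. by elim: w => //= d w ->; rewrite andbT; case: (4 < _); lia. Qed.

Lemma half_digits_digit c w : digit_word w -> digit_word (half_digits c w).
Proof.
elim: w c => //= d w IHw c /andP[d_lt /IHw ->]; rewrite andbT.
by case: c; lia.
Qed.

(** The second summand is the carry that [double_digits] drops at the front. *)
Lemma of_digits_double w : digit_word w ->
  of_digits (double_digits w) + (4 < head 0 w) * 10 ^ size w
    = 2 * of_digits w.
Proof.
elim: w => //= d w IHw /andP[d_lt /IHw {}IHw].
rewrite !of_digits_cons size_double_digits expnS.
have d_eq : 2 * d = 2 * d %% 10 + 10 * (4 < d) by case: ltnP; lia.
by rewrite mulnDr [2 * (d * _)]mulnA [X in _ = X * _ + _]d_eq -IHw; ring.
Qed.

Lemma of_digits_half c w :
  of_digits (half_digits c w) = (c * 10 ^ size w + of_digits w)./2.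
Proof.
elim: w c => [|d w IHw] c; first by case: c.
rewrite /= !of_digits_cons size_half_digits IHw expnS.
set x := c * 10 + d; set e := 10 ^ _.
(* Splitting off an even part lets [halfD] act without a carry; the odd rest is the remainder for
   the next digit. *)
have -> : c * (10 * e) + (d * e + of_digits w)
          = (x./2 * e).*2 + (odd x * e + of_digits w).
  have x_eq : c * 10 + d = odd x + x./2 * 2 by rewrite muln2 odd_double_half.
  rewrite -muln2 mulnA addnA -mulnDl x_eq; ring.
by rewrite [RHS]halfD odd_double doubleK.
Qed.

(** The extra leading 0 makes room for the last carry. *)
Definition double_word w := strip (double_digits (0 :: w)).
Definition half_word w := strip (half_digits false w).

Lemma of_digits_double_word w :
  digit_word w -> of_digits (double_word w) = 2 * of_digits w.
Proof.
move=> w_digits; rewrite of_digits_strip.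
by have := @of_digits_double (0 :: w) w_digits; rewrite /= mul0n addn0.
Qed.

Lemma of_digits_half_word w : of_digits (half_word w) = (of_digits w)./2.
Proof. by rewrite of_digits_strip of_digits_half. Qed.

Lemma canonical_double_word w : canonical w -> canonical (double_word w).
Proof.
case/andP=> w_digits w_gt0; apply: strip_canonical; first exact: double_digits_digit.
by rewrite -of_digits_strip of_digits_double_word // muln_gt0 of_digits_gt0.
Qed.

Lemma canonical_half_word w :
  canonical w -> ~~ odd (of_digits w) -> canonical (half_word w).
Proof.
case/andP=> w_digits w_gt0 w_even.
apply: strip_canonical; first exact: half_digits_digit.
by rewrite of_digits_half; have := of_digits_gt0 _ w_gt0; lia.
Qed.

(** * The operation on decimal words *)

(** Parity and results are read off the digits, so that evaluating the search below never builds
    large unary numbers. *)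
Definition word_choix_at (w : seq nat) (p q : nat) : seq (seq nat) :=
  let x := drop p (take q.+1 w) in
  if nth 0 w p == 0 then [::]
  else (take p w ++ double_word x ++ drop q.+1 w)
    :: (if odd (last 0 x) then [::]
        else [:: take p w ++ half_word x ++ drop q.+1 w]).

Definition word_choix (w : seq nat) : seq (seq nat) :=
  w :: flatten [seq word_choix_at w p q
               | p <- iota 0 (size w), q <- iota p (size w - p)].

Lemma canonical_block w p q :
  digit_word w -> 0 < nth 0 w p -> p <= q < size w ->
  canonical (drop p (take q.+1 w)).
Proof.
move=> w_digits wp_gt0 /andP[pq qw].
have size_x : size (take q.+1 w) = q.+1 by rewrite size_takel.
rewrite (drop_nth 0) ?size_x // nth_take // /canonical /= wp_gt0 andbT.
rewrite (allP w_digits) ?mem_nth //=; last exact: leq_ltn_trans pq qw.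
by apply/allP=> d /mem_drop/mem_take; apply: (allP w_digits).
Qed.

Lemma canonical_splice w p q y :
  canonical w -> canonical y -> canonical (take p w ++ y ++ drop q w).
Proof.
case/andP=> w_digits w_gt0 /andP[y_digits y_gt0]; apply/andP; split.
  rewrite !all_cat y_digits; apply/and3P; split=> //.
    by apply/allP=> d /mem_take; apply: (allP w_digits).
  by apply/allP=> d /mem_drop; apply: (allP w_digits).
(* The leading digit comes from [y] if [p] is 0 and from [w] otherwise. *)
case: w w_gt0 {w_digits} => // d w d_gt0; case: p => [|p] //.
by case: y y_gt0 {y_digits}.
Qed.

Lemma choix_atE w p q : canonical w -> p <= q < size w ->
  choix_at (of_digits w) p q = [seq of_digits x | x <- word_choix_at w p q].
Proof.
move=> w_can pq; rewrite /choix_at /splice /substr digits_of_digits //.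
rewrite /word_choix_at; case: eqP => // /eqP; rewrite -lt0n => wp_gt0.
have w_digits := proj1 (andP w_can).
have x_can := canonical_block _ _ _ w_digits wp_gt0 pq.
rewrite odd_of_digits; set x := drop p _ in x_can *.
have -> : digits (2 * of_digits x) = double_word x.
  rewrite -of_digits_double_word ?(proj1 (andP x_can)) //.
  exact/digits_of_digits/canonical_double_word.
rewrite /= -odd_of_digits; case: ifPn => // x_even /=.
have -> // : digits (of_digits x)./2 = half_word x.
by rewrite -of_digits_half_word; apply/digits_of_digits/canonical_half_word.
Qed.

Lemma choixE w : canonical w ->
  choix (of_digits w) = [seq of_digits x | x <- word_choix w].
Proof.
move=> w_can; rewrite /choix digits_of_digits //= map_flatten map_allpairs.
congr (_ :: flatten _); apply/eq_in_allpairs_dep=> p; rewrite mem_iota => p_lt q.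
by rewrite mem_iota => q_lt; apply: choix_atE => //; lia.
Qed.

(** Case analysis on one operation, with the block already known to be canonical and the indices in
    range. *)
Lemma word_choix_ind (P : seq nat -> Prop) w :
  canonical w -> P w ->
  (forall p q, let x := drop p (take q.+1 w) in
     canonical x -> p <= q < size w ->
     (P (take p w ++ double_word x ++ drop q.+1 w)) /\
     (~~ odd (of_digits x) -> P (take p w ++ half_word x ++ drop q.+1 w))) ->
  {in word_choix w, forall y, P y}.
Proof.
move=> w_can Pw Pstep y; rewrite inE => /predU1P[-> //|].
case/flattenP=> l /allpairsPdep[p [q [p_in q_in ->]]].
rewrite !mem_iota in p_in q_in.
have pq : p <= q < size w by lia.
rewrite /word_choix_at; case: eqP => // /eqP; rewrite -lt0n => wp_gt0.
have x_can := canonical_block _ _ _ (proj1 (andP w_can)) wp_gt0 pq.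
have [Pdouble Phalf] := Pstep p q x_can pq.
rewrite -odd_of_digits inE => /predU1P[-> //|].
by case: ifPn => // x_even; rewrite inE => /eqP->; apply: Phalf.
Qed.

Lemma word_choix_canonical w :
  canonical w -> {in word_choix w, forall y, canonical y}.
Proof.
move=> w_can; apply: word_choix_ind => // p q x x_can pq.
split=> [|x_even]; apply: canonical_splice => //.
  exact: canonical_double_word.
exact: canonical_half_word.
Qed.

Lemma word_choix_le w : canonical w ->
  {in word_choix w, forall y, of_digits y <= 10 * of_digits w}.
Proof.
move=> w_can.
(* The prefix moves up by at most one place, the block at most doubles, and the suffix keeps its
   place. *)
have replace_le u x v y : size y <= (size x).+1 -> of_digits y <= 2 * of_digits x ->
    of_digits (u ++ y ++ v) <= 10 * of_digits (u ++ x ++ v).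
  move=> y_size y_le; rewrite !of_digits_cat !size_cat.
  have pow_le : 10 ^ (size y + size v) <= 10 * 10 ^ (size x + size v).
    by rewrite -expnS leq_pexp2l // -addSn leq_add2r.
  by nia.
apply: word_choix_ind => // [|p q x x_can pq]; first by lia.
have w_eq : w = take p w ++ x ++ drop q.+1 w.
  have take_eq : take p (take q.+1 w) = take p w by rewrite take_takel //; lia.
  by rewrite catA -take_eq cat_take_drop cat_take_drop.
split=> [|_]; rewrite [in X in _ <= X]w_eq; apply: replace_le.
- by rewrite (leq_trans (size_strip _)) ?size_double_digits.
- by rewrite of_digits_double_word ?(proj1 (andP x_can)).
- by rewrite (leq_trans (size_strip _)) ?size_half_digits.
- by rewrite of_digits_half_word; lia.
Qed.

(** The same block is chosen, with both indices shifted by [size u]. *)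
Lemma word_choix_prefix (u w y : seq nat) :
  y \in word_choix w -> u ++ y \in word_choix (u ++ w).
Proof.
rewrite !inE => /predU1P[->|]; first by rewrite eqxx.
case/flattenP=> l /allpairsPdep[p [q [p_in q_in ->]]] y_in.
rewrite !mem_iota in p_in q_in; apply/orP; right; apply/flattenP.
exists (word_choix_at (u ++ w) (size u + p) (size u + q)).
  apply/allpairsPdep; exists (size u + p), (size u + q).
  by rewrite !mem_iota size_cat; split=> //; lia.
have takeE i : take (size u + i) (u ++ w) = u ++ take i w.
  by rewrite takeD take_size_cat // drop_size_cat.
have dropE i v : drop (size u + i) (u ++ v) = drop i v.
  by rewrite addnC -drop_drop drop_size_cat.
move: y_in; rewrite /word_choix_at -addnS !takeE !dropE.
rewrite nth_cat ltnNge leq_addr addKn /=.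
case: ifP => // _; rewrite -!catA !inE => /predU1P[->|]; first by rewrite eqxx.
case: ifP => // _; rewrite !inE => /eqP->.
by rewrite eqxx orbT.
Qed.

(** * Reachable numbers *)

Lemma reachableS n : reachable n.+1 = flatten (map choix (reachable n)).
Proof. by []. Qed.

Lemma reachable_word n m :
  m \in reachable n -> exists2 w, canonical w & m = of_digits w.
Proof.
elim: n m => [|n IHn] m; first by rewrite inE => /eqP->; exists [:: 1].
rewrite reachableS => /flatten_mapP[m' /IHn[w w_can ->]].
rewrite choixE // => /mapP[y y_in ->].
by exists y => //; apply: word_choix_canonical y_in.
Qed.

Lemma reachable_word_choix n w y : canonical w -> of_digits w \in reachable n ->
  y \in word_choix w -> of_digits y \in reachable n.+1.
Proof.
move=> w_can w_in y_in; rewrite reachableS; apply/flatten_mapP.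
by exists (of_digits w); rewrite // choixE // map_f.
Qed.

Lemma R_S n : R n.+1 <= 10 * R n.
Proof.
have /flatten_mapP[m m_in] := R_reachable n.+1.
have [w w_can m_eq] := reachable_word _ _ m_in.
rewrite m_eq choixE // => /mapP[y y_in ->].
apply: leq_trans (word_choix_le _ w_can _ y_in) _.
by rewrite leq_mul2l -m_eq R_ge.
Qed.

(** * The upper bound at step 14 *)

Fixpoint lex_le (u v : seq nat) : bool :=
  match u, v with
  | d :: u', e :: v' => (d < e) || (d == e) && lex_le u' v'
  | _, _ => true
  end.

Definition word_le (u v : seq nat) : bool :=
  (size u == size v) && lex_le u v || (size u < size v).

Lemma lex_le_of_digits u v : size u = size v -> digit_word u ->
  lex_le u v -> of_digits u <= of_digits v.
Proof.
elim: u v => [|d u IHu] [|e v] //= [uv] /andP[_ u_digits].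
rewrite !of_digits_cons uv => /orP[de|/andP[/eqP-> /IHu le_uv]]; last first.
  by rewrite leq_add2l le_uv.
by have := of_digits_lt _ u_digits; rewrite uv; nia.
Qed.

(** A shorter [u] is below [10 ^ size u], which the nonzero first digit of [v] already reaches. *)
Lemma word_le_of_digits u v : digit_word u -> 0 < head 0 v ->
  word_le u v -> of_digits u <= of_digits v.
Proof.
move=> u_digits v_gt0 /orP[/andP[/eqP uv]|uv]; first exact: lex_le_of_digits.
apply/ltnW/(leq_trans (of_digits_lt _ u_digits)).
case: v v_gt0 uv => //= e v e_gt0; rewrite ltnS => uv.
apply: (@leq_trans (10 ^ size v)); first by rewrite leq_pexp2l.
by rewrite of_digits_cons; nia.
Qed.

(* The words that still could exceed [T] when [k] further steps, each
   multiplying by at most 10, follow. *)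
Definition live (T : seq nat) (k : nat) (l : seq (seq nat)) : seq (seq nat) :=
  undup [seq w <- l | ~~ word_le (w ++ nseq k 0) T].

Fixpoint survivors (T : seq nat) (k : nat) (l : seq (seq nat)) : seq (seq nat) :=
  if k is k'.+1 then survivors T k' (live T k' (flatten (map word_choix l)))
  else l.

(** The hypothesis on [reachable n] is the invariant of the search: a number is either too small to
    exceed [T] after [k] more factors of 10, or still listed. *)
Lemma no_survivors_bound T k l n :
    0 < head 0 T ->
    {in reachable n, forall m, m * 10 ^ k <= of_digits T \/
       exists w, [/\ w \in l, canonical w & m = of_digits w]} ->
    survivors T k l = [::] ->
  R (n + k) <= of_digits T.
Proof.
move=> T_gt0; elim: k l n => [|k IHk] l n reach_l /= no_surv.
  rewrite addn0; have := reach_l _ (R_reachable n); rewrite muln1 => -[//|].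
  by rewrite no_surv => -[w []].
rewrite addnS -addSn; apply: (IHk _ n.+1) no_surv => m.
rewrite reachableS => /flatten_mapP[m' m'_in].
have [w w_can m'_eq] := reachable_word _ _ m'_in.
rewrite m'_eq choixE // => /mapP[y y_in m_eq].
have y_can := word_choix_canonical _ w_can _ y_in.
have y_le := word_choix_le _ w_can _ y_in.
have [m'_le|[x [x_l x_can m'x]]] := reach_l _ m'_in.
  (* A discarded number stays discarded: the step uses up one of the factors 10. *)
  by left; rewrite expnS m'_eq m_eq in m'_le *; nia.
have xw : x = w by rewrite -[x]digits_of_digits // -[w]digits_of_digits // -m'_eq -m'x.
have [y_le_T|y_live] := boolP (word_le (y ++ nseq k 0) T).
  left; have := word_le_of_digits _ _ _ T_gt0 y_le_T.
  rewrite of_digits_cat of_digits_zeros size_nseq addn0 m_eq; apply.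
  by rewrite all_cat (proj1 (andP y_can)) all_nseq orbT.
right; exists y; split=> //; rewrite mem_undup mem_filter y_live.
by apply/flatten_mapP; exists w; rewrite // -xw.
Qed.

Lemma R_le_no_survivors T k :
  survivors T k [:: [:: 1]] = [::] -> 0 < head 0 T -> R k <= of_digits T.
Proof.
move=> no_surv T_gt0; apply: (no_survivors_bound _ _ _ 0 T_gt0 _ no_surv) => m.
by rewrite inE => /eqP->; right; exists [:: 1].
Qed.

Lemma R_le n : 14 <= n -> R n <= of_digits [:: 8; 1; 1; 3] * 10 ^ (n - 9).
Proof.
elim: n => // n IHn; rewrite leq_eqVlt => /predU1P[<-|n_ge].
  (* The threshold is 8113 * 10^5, since 8.113 * 10^(n-6) = 8113 * 10^(n-9). *)
  have no_surv : survivors ([:: 8; 1; 1; 3] ++ nseq 5 0) 14 [:: [:: 1]] = [::].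
    by vm_compute.
  have := R_le_no_survivors _ _ no_surv isT.
  by rewrite of_digits_cat of_digits_zeros size_nseq addn0.
apply: leq_trans (R_S n) _; rewrite subSn ?expnS; last by lia.
by rewrite mulnCA leq_mul2l IHn.
Qed.

(** * The self-reproducing cycle *)

Definition word_88224_path : seq (seq nat) :=
  [:: [:: 2]; [:: 4]; [:: 8]; [:: 1; 6]; [:: 1; 1; 2]; [:: 2; 2; 4];
      [:: 4; 4; 8]; [:: 4; 4; 1; 6]; [:: 4; 4; 1; 1; 2]; [:: 8; 8; 2; 2; 4]].

Definition cycle_words : seq (seq nat) :=
  [:: [:: 8; 8; 2; 2; 4]; [:: 8; 1; 6; 4; 4; 8]; [:: 8; 1; 6; 4; 4; 1; 6];
      [:: 8; 1; 6; 4; 4; 1; 1; 2]].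

Lemma word_path_reachable w s n :
  canonical w -> of_digits w \in reachable n ->
  path (fun x y => y \in word_choix x) w s ->
  canonical (last w s) /\ of_digits (last w s) \in reachable (n + size s).
Proof.
elim: s w n => [|y s IHs] w n w_can w_in /=; first by rewrite addn0.
case/andP=> y_in; rewrite addnS -addSn; apply: IHs.
  exact: word_choix_canonical y_in.
exact: reachable_word_choix y_in.
Qed.

(** Here [u] is what the cycle leaves behind: empty until it closes, then 8112. *)
Lemma cycle_words_step v : v \in cycle_words ->
  exists u v', [/\ v' \in cycle_words, u ++ v' \in word_choix v
                 & size (u ++ v') = (size v).+1].
Proof.
(* The doubled suffixes are, in order, 8224, 8, 6 and 644112; each gains a digit. *)
rewrite !inE => /or4P[] /eqP->.
- by exists [::], [:: 8; 1; 6; 4; 4; 8].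
- by exists [::], [:: 8; 1; 6; 4; 4; 1; 6].
- by exists [::], [:: 8; 1; 6; 4; 4; 1; 1; 2].
- by exists [:: 8; 1; 1; 2], [:: 8; 8; 2; 2; 4].
Qed.

Lemma reachable_8112 n : 14 <= n -> exists u v,
  let w := [:: 8; 1; 1; 2] ++ u ++ v in
  [/\ v \in cycle_words, canonical w, of_digits w \in reachable n
    & size (u ++ v) = n - 9].
Proof.
elim: n => // n IHn; rewrite leq_eqVlt => /predU1P[<-|n_ge].
  exists [::], [:: 8; 8; 2; 2; 4].
  (* Ten steps lead from 1 to 88224 and four more run the cycle once, ending at 811288224 after step
     14. *)
  have [|||w_can w_in] := @word_path_reachable [:: 1]
      (word_88224_path ++ behead cycle_words ++ [:: [:: 8; 1; 1; 2; 8; 8; 2; 2; 4]]) 0.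
  - by [].
  - exact: mem_head.
  - by vm_compute.
  by split; [exact: mem_head | exact: w_can | exact: w_in |].
have [u [v [v_in w_can w_in size_uv]]] := IHn n_ge.
have [u' [v' [v'_in step size_v']]] := cycle_words_step _ v_in.
exists (u ++ u'), v'; have step_w := word_choix_prefix ([:: 8; 1; 1; 2] ++ u) _ _ step.
rewrite -!catA in step_w *; split=> //.
- exact: word_choix_canonical step_w.
- exact: reachable_word_choix step_w.
- rewrite size_cat size_v' addnS -size_cat size_uv; lia.
Qed.

Lemma R_gt n : 14 <= n -> of_digits [:: 8; 1; 1; 2] * 10 ^ (n - 9) < R n.
Proof.
move=> n_ge; have [u [v [v_in _ w_in size_uv]]] := reachable_8112 _ n_ge.
apply: leq_trans (R_ge w_in).
rewrite of_digits_cat size_uv -addn1 leq_add2l of_digits_cat addn_gt0.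
(* Strictness comes from the tail: every cycle word begins with 8. *)
rewrite [X in _ || X]of_digits_gt0 ?orbT //.
by move: v_in; rewrite !inE => /or4P[] /eqP->.
Qed.

(** * The bounds over the rationals *)

Local Open Scope ring_scope.

Lemma div_mul_exp10 (F : numFieldType) (a c j k : nat) : c = (10 ^ j)%N ->
  a%:R / c%:R * 10%:R ^+ (j + k) = (a * 10 ^ k)%:R :> F.
Proof.
move=> ->; rewrite exprD mulrA natrX mulfVK ?natrM ?natrX //.
by rewrite expf_neq0 // pnatr_eq0.
Qed.

Theorem theorem6 (n : nat) (n_ge14 : (14 <= n)%N) :
  8112%:R / 1000%:R * 10%:R ^+ (n - 6) < (R n)%:R :> rat /\
  (R n)%:R <= 8113%:R / 1000%:R * 10%:R ^+ (n - 6) :> rat.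
Proof.
have n_eq : (n - 6 = 3 + (n - 9))%N by lia.
have thousand : 1000%N = (10 ^ 3)%N by [].
have <- : of_digits [:: 8; 1; 1; 2]%N = 8112%N by vm_compute.
have <- : of_digits [:: 8; 1; 1; 3]%N = 8113%N by vm_compute.
move: (R_gt n n_ge14) (R_le n n_ge14).
(* The constants become variables, so that no later step unfolds them as unary numerals. *)
move: (of_digits [:: 8; 1; 1; 2]%N) (of_digits [:: 8; 1; 1; 3]%N) => a b.
rewrite n_eq; move: thousand; move: 1000%N => c thousand a_lt b_ge.
by rewrite !div_mul_exp10 // ltr_nat ler_nat.
Qed.
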